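(* Let $N=2M$ and let $W_z=e^{zK}$ be the entire group attached to a finite irreducible reversible generator as in the context. For every real $\theta$ the matrix $U_\theta:=W_{i\theta}=e^{i\theta K}$ is real orthogonal with determinant one, $U_\theta\in\mathrm{SO}(N,\mathbb{R})$, and therefore also unitary, $U_\theta\in\mathrm{U}(N)$. Equivalently, the imaginary slice is the Schrödinger evolution $$U_\theta=e^{-i\theta H_{\mathrm{NUO}}},\qquad H_{\mathrm{NUO}}:=-K=-\sigma^y\otimes A=H_{\mathrm{NUO}}^{*},$$ generated by the Hermitian Hamiltonian $H_{\mathrm{NUO}}$. For any density matrix $\sigma_0$ on $\mathbb{C}^N$ (Hermitian, positive semidefinite, unit trace), the matrix $\sigma_\theta:=U_\theta\sigma_0U_\theta^{*}$ is Hermitian, positive and of unit trace, and obeys the von Neumann equation $$\frac{d\sigma_\theta}{d\theta}=-i[H_{\mathrm{NUO}},\sigma_\theta].$$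
   Context: Let $M\ge 2$ and let $Q=(Q_{ij})_{1\le i,j\le M}$ be the generator of an irreducible continuous-time Markov chain: $Q_{ij}\ge0$ for $i\neq j$ and $Q_{ii}=-\sum_{j\ne i}Q_{ij}$. Let $\nu$ be its unique stationary probability vector (strictly positive, $Q^{T}\nu=0$), and assume reversibility (detailed balance): $\nu_iQ_{ij}=\nu_jQ_{ji}$ for all $i,j$. Fix $\Lambda>0$ with $\Lambda\ge\max_i(-Q_{ii})$ and set $P:=\mathrm{I}+\tfrac1\Lambda Q$, $D:=\mathrm{diag}(\sqrt{\nu_1},\dots,\sqrt{\nu_M})$, $A:=DPD^{-1}$ (real symmetric by reversibility). Let $\sigma^y=\begin{pmatrix}0&-i\\ i&0\end{pmatrix}$, $K:=\sigma^y\otimes A=\begin{pmatrix}0&-iA\\ iA&0\end{pmatrix}$ and $W_z:=e^{zK}$ for $z\in\mathbb{C}$. ${}^*$ denotes the conjugate transpose and $[X,Y]=XY-YX$. *)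

(* Defs.v *)
From HB Require Import structures.
From mathcomp Require Import all_boot all_order all_algebra.
From mathcomp Require Import spectral sesquilinear.
From mathcomp Require Import mathcomp_extra boolp classical_sets functions reals.
From mathcomp Require Import topology normedtype sequences.
From mathcomp.real_closed Require Import complex mxtens.

Set Implicit Arguments.
Unset Strict Implicit.
Unset Printing Implicit Defensive.
Set Warnings "-redundant-canonical-projection".

Import Order.TTheory GRing.Theory Num.Theory.
Import numFieldNormedType.Exports.

Local Open Scope classical_set_scope.
Local Open Scope ring_scope.
Local Open Scope sesquilinear_scope.

(* R[i] gets the topology of its modulus, the generic one of a
   numClosedFieldType, so that matrices over R[i] are normed modules. *)
HB.instance Definition _ (R : realType) :=
  PseudoPointedMetric.copy R[i] (R[i] : numClosedFieldType).
HB.instance Definition _ (R : realType) :=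
  NormedModule.copy R[i] (R[i] : numClosedFieldType).

Section Generator.
Context {R : realType} {M : nat}.
Implicit Types (Q : 'M[R]_M) (nu : 'cV[R]_M) (Lambda : R).

Definition is_generator Q : Prop :=
  (forall i j, i != j -> 0 <= Q i j) /\
  (forall i, Q i i = - \sum_(j < M | j != i) Q i j).

(* Every state leads to every state through jumps of positive rate. *)
Definition irreducible_generator Q : Prop :=
  forall i j, connect [rel k l | (k != l) && (0 < Q k l)] i j.

(* For an irreducible generator, uniqueness and strict positivity follow. *)
Definition stationary_prob Q nu : Prop :=
  [/\ forall i, 0 <= nu i 0, \sum_i nu i 0 = 1 & Q^T *m nu = 0].

Definition reversible Q nu : Prop :=
  forall i j, nu i 0 * Q i j = nu j 0 * Q j i.

Definition uniformized Lambda Q : 'M[R]_M := 1%:M + Lambda^-1 *: Q.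

Definition sqrt_diag nu : 'M[R]_M := diag_mx (\row_i Num.sqrt (nu i 0)).

Definition symmetrized Lambda Q nu : 'M[R]_M :=
  sqrt_diag nu *m uniformized Lambda Q *m invmx (sqrt_diag nu).

End Generator.

Section Quantum.
Context {R : realType}.

Definition mexp {n} (A : 'M[R[i]]_n) : 'M[R[i]]_n :=
  lim (series (fun k => k`!%:R^-1 *: A ^+ k) @ \oo).

Definition complexmx {m n} (A : 'M[R]_(m, n)) : 'M[R[i]]_(m, n) :=
  map_mx (real_complex R) A.

Definition sigma_y : 'M[R[i]]_2 :=
  \matrix_(i < 2, j < 2)
    nth 0 (nth [::] [:: [:: 0;   - 'i];
                        [:: 'i;  0   ]] i) j.

Definition K_mx {M} (A : 'M[R]_M) : 'M[R[i]]_(2 * M) :=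
  tensmx sigma_y (complexmx A).

Definition W_mx {M} (A : 'M[R]_M) (z : R[i]) : 'M[R[i]]_(2 * M) :=
  mexp (z *: K_mx A).

Definition H_NUO {M} (A : 'M[R]_M) : 'M[R[i]]_(2 * M) := - K_mx A.

Definition special_orthogonal {n} (V : 'M[R]_n) : Prop :=
  V^T *m V = 1%:M /\ \det V = 1.

(* In R[i], 0 <= z means that z is real and nonnegative. *)
Definition psdmx {n} (S : 'M[R[i]]_n) : Prop :=
  forall v : 'cV[R[i]]_n, 0 <= (v ^t* *m S *m v) 0 0.

Definition density_mx {n} (S : 'M[R[i]]_n) : Prop :=
  [/\ S \is hermsymmx, psdmx S & \tr S = 1].

Definition commutator_mx {n} (X Y : 'M[R[i]]_n) : 'M[R[i]]_n :=
  X *m Y - Y *m X.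

(* 'D_v and is_derive require source and target to be modules over the same
   field, whereas here a matrix over R[i] depends on a real parameter. *)
Definition has_real_derivative {m n}
    (f : R -> 'M[R[i]]_(m, n)) (t : R) (df : 'M[R[i]]_(m, n)) : Prop :=
  (h%:C%C)^-1 *: (f (t + h) - f t) @[h --> (0 : R)^'] --> df.

Lemma K_mxE M (A : 'M[R]_M) (eqM : (M + M = 2 * M)%N) :
  K_mx A = castmx (eqM, eqM)
    (block_mx 0 (- 'i *: complexmx A) ('i *: complexmx A) 0).
Proof.
apply/matrixP => i j; rewrite castmxE /=.
case: i / (mxtens_indexP i) => a k; case: j / (mxtens_indexP j) => b l.
rewrite tensmxE.
have cst (c : 'I_2) (p : 'I_M) :
    cast_ord (esym eqM) (mxtens_index (c, p)) =
    if val c == 0%N then lshift M p else rshift M p.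
  apply: val_inj; case: c => -[|[|//]] ? /=; first by rewrite mul0n add0n.
  by rewrite mul1n.
rewrite !cst [sigma_y a b]mxE.
case: a => -[|[|//]] ha; case: b => -[|[|//]] hb /=.
- by rewrite block_mxEul mul0r mxE.
- by rewrite block_mxEur !mxE.
- by rewrite block_mxEdl !mxE.
- by rewrite block_mxEdr mul0r mxE.
Qed.

End Quantum.

(* Main.v *)
Require Import Defs.
From mathcomp Require Import all_boot all_order all_algebra.
From mathcomp Require Import spectral sesquilinear.
From mathcomp Require Import mathcomp_extra boolp classical_sets functions reals.
From mathcomp Require Import topology normedtype sequences.
From mathcomp Require Import derive trigo realfun ring.
From mathcomp.real_closed Require Import complex mxtens.

Set Implicit Arguments.
Unset Strict Implicit.
Unset Printing Implicit Defensive.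

Import Order.TTheory GRing.Theory Num.Theory.
Import numFieldNormedType.Exports.

Local Open Scope classical_set_scope.
Local Open Scope ring_scope.
Local Open Scope sesquilinear_scope.

(** Everything is read off an orthonormal eigenbasis of K = sigma_y (x) A.

    Detailed balance makes D P D^-1 symmetric ([symmetrized_sym]), once D is
    known to be invertible; this follows from irreducibility, which forces the
    stationary vector to be positive ([stationary_prob_gt0]). So K is Hermitian
    ([K_mx_hermitian]), and by the spectral theorem K = P^* diag(d) P with P
    unitary and d real. Conjugation by P commutes with the exponential series,
    and on each eigenvalue the series sums to a point of the unit circle by
    Euler's formula ([cvg_exp_cis]); hence
      exp (i t K) = P^* diag(cis (t d_j)) P,
    which is [cvg_exp_hermitian].

    Three properties follow. The evolution is unitary because its eigenvalues
    have modulus one. Its determinant is cis (t tr K) = 1 because sigma_y has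
    zero diagonal. It is real because i K is: sigma_y is purely imaginary and A
    is real ([iK_mx_real], [conj_cvg_exp]); and a real unitary matrix is
    orthogonal.

    Conjugation by a unitary matrix preserves density matrices
    ([density_mx_unitary]). For the von Neumann equation, in the eigenbasis the
    entry (j, k) of the state at time t is its initial value times
    cis (t (d_j - d_k)), and its derivative is i (d_j - d_k) times itself, which
    is the same entry of i [diag(d), .] ([derivative_hermitian_evolution]). *)

(** * Limits of complex numbers and matrices *)

(** The modulus of a complex number restricts to the absolute value on the reals. *)
Lemma cvg_real_complex (R : realType) (T : Type) (F : set_system T)
    {FF : Filter F} (f : T -> R) (a : R) :
  f x @[x --> F] --> a -> (f x)%:C%C @[x --> F] --> a%:C%C.
Proof.
move=> fa; apply/cvgrPdist_lt => -[e e'] /=; rewrite ltcE /= => /andP[/eqP-> e0].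
near=> x; rewrite -rmorphB normc_def /= expr0n addr0 sqrtr_sqr ltcR.
by near: x; move/cvgrPdist_lt: fa; exact.
Unshelve. all: by end_near. Qed.

Lemma cvg_conj (C : numClosedFieldType) (T : Type) (F : set_system T)
    {FF : Filter F} (f : T -> C) (a : C) :
  f x @[x --> F] --> a -> Num.conj (f x) @[x --> F] --> Num.conj a.
Proof.
move=> fa; apply/cvgrPdist_lt => e e0; near=> x.
by rewrite -rmorphB norm_conjC; near: x; move/cvgrPdist_lt: fa; exact.
Unshelve. all: by end_near. Qed.

(** A matrix is a finite combination of elementary matrices, so limits can be
    taken entry by entry. *)
Lemma cvg_mx_entrywise (K : numFieldType) (m n : nat) (T : Type) (F : set_system T)
    {FF : Filter F} (f : T -> 'M[K]_(m, n)) (a : 'M[K]_(m, n)) :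
  (forall i j, f x i j @[x --> F] --> a i j) -> f x @[x --> F] --> a.
Proof.
move=> fa; rewrite [a]matrix_sum_delta.
under eq_fun do rewrite [f _]matrix_sum_delta.
apply: cvg_big => [|i _]; first exact: add_continuous.
apply: cvg_big => [|j _]; first exact: add_continuous.
by apply: cvgZl; exact: fa.
Qed.

Lemma cvg_mulmx_entrywise (K : numFieldType) (m n p q : nat) (T : Type) (F : set_system T)
    {FF : Filter F} (B : 'M[K]_(m, n)) (C : 'M[K]_(p, q))
    (f : T -> 'M[K]_(n, p)) (a : 'M[K]_(n, p)) :
  (forall i j, f x i j @[x --> F] --> a i j) -> B *m f x *m C @[x --> F] --> B *m a *m C.
Proof.
move=> fa; apply: cvg_mx_entrywise => i j; rewrite mxE; under eq_fun do rewrite mxE.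
apply: cvg_big => [|k _]; first exact: add_continuous.
apply: cvgM; last exact: cvg_cst.
rewrite mxE; under eq_fun do rewrite mxE.
apply: cvg_big => [|l _]; first exact: add_continuous.
by apply: cvgM; [exact: cvg_cst|exact: fa].
Qed.

Lemma is_derive_cvg_quotient (R : realType) (f : R -> R) (x df : R) :
  is_derive x 1 f df -> h^-1 * (f (x + h) - f x) @[h --> (0 : R)^'] --> df.
Proof.
move=> [fx <-]; rewrite /derive.
apply: cvg_trans fx; apply: near_eq_cvg; near=> h.
by rewrite /= [h *: 1]mulr1 (addrC x).
Unshelve. all: by end_near. Qed.

(** * The complex exponential on the imaginary axis *)

Lemma conj_real_complex (R : realType) (x : R) : Num.conj x%:C%C = x%:C%C.
Proof. exact: conjc_real. Qed.

(** The point of angle [x] on the unit circle: it plays the role of exp (i x). *)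
Definition cis (R : realType) (x : R) : R[i] :=
  (cos x)%:C%C + 'i * (sin x)%:C%C.

(** Powers of 'i have period four: the even ones give the signs of the cosine
    series, the odd ones those of the sine series. *)
Lemma exp_coeff_cis (R : realType) (x : R) k :
  k`!%:R^-1 * ('i * x%:C%C) ^+ k =
    (cos_coeff x k)%:C%C + 'i * (sin_coeff x k)%:C%C :> R[i].
Proof.
rewrite /cos_coeff /sin_coeff /= !rmorphM /= !fmorphV /= !rmorph_nat.
rewrite !rmorphXn /= !rmorphN1 exprMn.
have -> : 'i ^+ k = 'i ^+ odd k * (-1) ^+ k./2 :> R[i].
  by rewrite -sqrCi -exprM mul2n -exprD odd_double_half.
(* The sine coefficient has a truncated [k.-1], so [k = 0] stands apart. *)
case: k => [|k] /=; first by rewrite !mul0r mulr0 addr0 !expr0 !mul1r !mulr1.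
rewrite uphalf_half; case: (odd k) => /=; rewrite ?add0n ?add1n ?expr0 ?expr1; ring.
Qed.

(** Euler's formula, with the complex exponential given by its power series. *)
Lemma cvg_exp_cis (R : realType) (x : R) :
  series (fun k => k`!%:R^-1 * ('i * x%:C%C) ^+ k) @ \oo --> cis x.
Proof.
have -> : series (fun k => k`!%:R^-1 * ('i * x%:C%C) ^+ k) =
    (fun n => (series (cos_coeff x) n)%:C%C + 'i * (series (sin_coeff x) n)%:C%C).
  apply/funext => n; rewrite /series /= !rmorph_sum mulr_sumr -big_split /=.
  by apply: eq_bigr => k _; exact: exp_coeff_cis.
apply: cvgD.
  apply: cvg_real_complex; rewrite unlock; exact: is_cvg_series_cos_coeff.
apply: cvgM; first exact: cvg_cst.
apply: cvg_real_complex; rewrite unlock; exact: is_cvg_series_sin_coeff.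
Qed.

Lemma cisD (R : realType) (x y : R) : cis (x + y) = cis x * cis y.
Proof.
rewrite /cis cosD sinD rmorphB rmorphD !rmorphM /=.
have := sqrCi (complex R); set I := 'i.
set a := (cos x)%:C%C; set b := (cos y)%:C%C; set c := (sin x)%:C%C; set d := (sin y)%:C%C.
move=> I2; transitivity (a * b + I ^+ 2 * (c * d) + I * (c * b + a * d)).
  by rewrite I2; ring.
by ring.
Qed.

Lemma cis0 (R : realType) : cis 0 = 1 :> R[i].
Proof. by rewrite /cis cos0 sin0 mulr0 addr0. Qed.

Lemma conj_cis (R : realType) (x : R) : Num.conj (cis x) = cis (- x).
Proof.
by rewrite /cis rmorphD rmorphM /= conjCi !conj_real_complex cosN sinN rmorphN mulrN mulNr.
Qed.

Lemma cis_sum (R : realType) (I : finType) (f : I -> R) :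
  cis (\sum_i f i) = \prod_i cis (f i).
Proof. exact: (big_morph _ (@cisD R) (@cis0 R)). Qed.

(** The derivative of s |-> exp (i s d), written as a limit of quotients because
    the variable is real and the values are complex. *)
Lemma cvg_quotient_cis (R : realType) (d t : R) :
  (h%:C%C)^-1 * (cis ((t + h) * d) - cis (t * d)) @[h --> (0 : R)^'] -->
  'i * d%:C%C * cis (t * d).
Proof.
have quot (f : R -> R) df : is_derive (t * d) 1 f df ->
    (h^-1 * (f ((t + h) * d) - f (t * d)))%:C%C @[h --> (0 : R)^'] --> (df * d)%:C%C.
  move=> fd; apply: cvg_real_complex.
  have gd : is_derive t 1 ( *%R ^~ d) d.
    rewrite (_ : *%R^~ d = d \*: id); last by apply/funext => y; exact: mulrC.
    by apply: is_derive_eq; exact: mulr1.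
  exact: (is_derive_cvg_quotient (is_derive1_comp (g := *%R ^~ d) fd gd)).
have -> : 'i * d%:C%C * cis (t * d) = (- sin (t * d) * d)%:C%C + 'i * (cos (t * d) * d)%:C%C.
  rewrite /cis !rmorphM /= rmorphN.
  have := sqrCi (complex R); set I := 'i => I2.
  transitivity (I * d%:C%C * (cos (t * d))%:C%C + I ^+ 2 * d%:C%C * (sin (t * d))%:C%C); first by ring.
  by rewrite I2; ring.
have E h : (h%:C%C)^-1 * (cis ((t + h) * d) - cis (t * d)) =
  (h^-1 * (cos ((t + h) * d) - cos (t * d)))%:C%C
   + 'i * (h^-1 * (sin ((t + h) * d) - sin (t * d)))%:C%C.
  by rewrite /cis !rmorphM /= fmorphV !rmorphB; ring.
under eq_fun do rewrite E.
apply: cvgD; first exact: quot.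
by apply: cvgM; [exact: cvg_cst | exact: quot].
Qed.

(** * Conjugation by a unitary matrix *)

Lemma trmxC_mul_unitary (C : numClosedFieldType) n (U : 'M[C]_n) :
  U \is unitarymx -> U^t* *m U = 1%:M.
Proof. by move=> Uu; rewrite -invmx_unitary// mulVmx// unitarymx_unit. Qed.

Lemma unitary_conjmx_det (C : numClosedFieldType) n (P X : 'M[C]_n) :
  P \is unitarymx -> \det (P^t* *m X *m P) = \det X.
Proof.
move=> Pu; rewrite !det_mulmx mulrAC -det_mulmx trmxC_mul_unitary//.
by rewrite det1 mul1r.
Qed.

Lemma unitary_conjmx_trace (C : numClosedFieldType) n (P X : 'M[C]_n) :
  P \is unitarymx -> \tr (P^t* *m X *m P) = \tr X.
Proof.
by move=> Pu; rewrite mxtrace_mulC mulmxA (unitarymxP Pu) mul1mx.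
Qed.

Lemma unitary_conjmxM (C : numClosedFieldType) n (P X Y : 'M[C]_n) :
  P \is unitarymx ->
  P^t* *m X *m P *m (P^t* *m Y *m P) = P^t* *m (X *m Y) *m P.
Proof. by move=> Pu; rewrite !mulmxA (mulmxtVK _ Pu). Qed.

Lemma conjmx_trmxCB (C : numClosedFieldType) n (P X Y : 'M[C]_n) :
  P^t* *m X *m P - P^t* *m Y *m P = P^t* *m (X - Y) *m P.
Proof. by rewrite mulmxBr mulmxBl. Qed.

Lemma conjmx_trmxCZ (C : numClosedFieldType) n (P X : 'M[C]_n) (a : C) :
  a *: (P^t* *m X *m P) = P^t* *m (a *: X) *m P.
Proof. by rewrite -scalemxAr -scalemxAl. Qed.

Lemma unitary_conjmxX (C : numClosedFieldType) n (P : 'M[C]_n) (d : 'rV[C]_n) k :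
  P \is unitarymx ->
  (P^t* *m diag_mx d *m P) ^+ k = P^t* *m diag_mx (\row_j d 0 j ^+ k) *m P.
Proof.
move=> Pu; elim: k => [|k IH].
  rewrite expr0 (_ : diag_mx _ = 1%:M) ?mulmx1 ?trmxC_mul_unitary//.
  by apply/matrixP => i j; rewrite !mxE expr0.
rewrite exprS IH -mulmxE unitary_conjmxM// mulmx_diag.
by congr (_ *m diag_mx _ *m _); apply/rowP => j; rewrite !mxE exprS.
Qed.

Lemma density_mx_unitary (R : realType) n (U S : 'M[R[i]]_n) :
  U \is unitarymx -> density_mx S -> density_mx (U *m S *m U^t*).
Proof.
move=> Uu [/is_hermitianmxP Sh Spos Str]; rewrite expr0 scale1r in Sh; split.
- apply/is_hermitianmxP; rewrite expr0 scale1r !trmx_mul !map_mxM /= trmxCK.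
  by rewrite -Sh mulmxA.
- move=> v; have := Spos (U^t* *m v).
  by rewrite trmx_mul map_mxM /= trmxCK !mulmxA.
- by rewrite mxtrace_mulC mulmxA trmxC_mul_unitary// mul1mx.
Qed.

(** * Matrix exponentials *)

Lemma mexpE (R : realType) n (X E : 'M[R[i]]_n) :
  series (fun k => k`!%:R^-1 *: X ^+ k) @ \oo --> E -> mexp X = E.
Proof. by apply: cvg_lim; exact: norm_hausdorff. Qed.

(** The partial sums are real, conjugation is continuous, and limits of matrices
    are unique. *)
Lemma conj_cvg_exp (R : realType) n (X E : 'M[R[i]]_n) :
  series (fun k => k`!%:R^-1 *: X ^+ k) @ \oo --> E ->
  map_mx Num.conj X = X -> map_mx Num.conj E = E.
Proof.
move=> XE Xr; suff XE' : series (fun k => k`!%:R^-1 *: X ^+ k) @ \oo --> map_mx Num.conj E.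
  by rewrite -[RHS](mexpE XE) (mexpE XE').
have Sr m : map_mx Num.conj (series (fun k => k`!%:R^-1 *: X ^+ k) m) =
    series (fun k => k`!%:R^-1 *: X ^+ k) m.
  rewrite /series /= raddf_sum; apply: eq_bigr => k _.
  by rewrite /= map_mxZ fmorphV rmorph_nat rmorphXn /= Xr.
apply: cvg_mx_entrywise => i j.
rewrite (_ : (fun m => _) = fun m =>
    Num.conj (series (fun k => k`!%:R^-1 *: X ^+ k) m i j)); last first.
  by apply/funext => m; have /matrixP/(_ i j) := Sr m; rewrite mxE => ->.
rewrite mxE; apply: cvg_conj.
exact: (continuous_cvg _ (@coord_continuous _ _ _ i j E) XE).
Qed.

(** Conjugation by a unitary matrix turns the exponential series into scalar
    series, one per eigenvalue. *)
Lemma cvg_exp_unitary (R : realType) n (P : 'M[R[i]]_n) (d e : 'rV[R[i]]_n) :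
  P \is unitarymx ->
  (forall j, series (fun k => k`!%:R^-1 * d 0 j ^+ k) @ \oo --> e 0 j) ->
  series (fun k => k`!%:R^-1 *: (P^t* *m diag_mx d *m P) ^+ k) @ \oo -->
    P^t* *m diag_mx e *m P.
Proof.
move=> Pu de.
have -> : series (fun k => k`!%:R^-1 *: (P^t* *m diag_mx d *m P) ^+ k) =
  (fun m => P^t* *m diag_mx (\row_j series (fun k => k`!%:R^-1 * d 0 j ^+ k) m) *m P).
  apply/funext => m; rewrite /series /=.
  under eq_bigr do rewrite unitary_conjmxX// conjmx_trmxCZ.
  rewrite -mulmx_suml -mulmx_sumr; congr (_ *m _ *m _).
  apply/matrixP => i j; rewrite summxE !mxE -sumrMnl.
  by apply: eq_bigr => k _; rewrite !mxE mulrnAr.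
apply: cvg_mulmx_entrywise => i j.
rewrite mxE; under eq_fun do rewrite 2!mxE.
have [_|_] := eqVneq i j; last by under eq_fun do rewrite mulr0n; exact: cvg_cst.
under eq_fun do rewrite mulr1n.
exact: de.
Qed.

(** * Unitary evolution generated by a Hermitian matrix *)

(** The eigenvalues are given as real numbers, so that they can serve as
    frequencies in [phase_mx]. *)
Lemma hermitian_spectral (R : realType) n (G : 'M[R[i]]_n) :
  G \is hermsymmx ->
  exists2 P : 'M[R[i]]_n, P \is unitarymx &
    exists d : 'rV[R]_n, G = P^t* *m diag_mx (complexmx d) *m P.
Proof.
move=> Gh; exists (spectralmx G); first exact: spectral_unitarymx.
exists (map_mx (@complex.Re R) (spectral_diag G)).
have -> : complexmx (map_mx (@complex.Re R) (spectral_diag G)) = spectral_diag G.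
  apply/matrixP => i j; rewrite !mxE RRe_real//.
  exact: (mxOverP (hermitian_spectral_diag_real Gh)).
rewrite -invmx_unitary ?spectral_unitarymx//.
exact/orthomx_spectralP/hermitian_normalmx.
Qed.

(** The matrix of exp (i t G) in an eigenbasis of a Hermitian G with eigenvalues
    [d]. *)
Definition phase_mx (R : realType) n (d : 'rV[R]_n) (t : R) : 'M[R[i]]_n :=
  diag_mx (\row_j cis (t * d 0 j)).

(** In an eigenbasis, Euler's formula applies to each eigenvalue. *)
Lemma cvg_exp_hermitian (R : realType) n (P : 'M[R[i]]_n) (d : 'rV[R]_n) (t : R) :
  P \is unitarymx ->
  series (fun k => k`!%:R^-1 *:
    (('i * t%:C%C) *: (P^t* *m diag_mx (complexmx d) *m P)) ^+ k) @ \oo -->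
    P^t* *m phase_mx d t *m P.
Proof.
move=> Pu.
have -> : ('i * t%:C%C) *: (P^t* *m diag_mx (complexmx d) *m P) =
    P^t* *m diag_mx (\row_j ('i * (t * d 0 j)%:C%C)) *m P.
  rewrite conjmx_trmxCZ; congr (_ *m _ *m _).
  by apply/matrixP => i j; rewrite !mxE rmorphM /= mulrnAr mulrA.
apply: cvg_exp_unitary => // j; rewrite mxE.
under [X in series X]eq_fun do rewrite mxE.
exact: cvg_exp_cis.
Qed.

Lemma conj_phase_mx (R : realType) n (d : 'rV[R]_n) (t : R) :
  (phase_mx d t)^t* = phase_mx d (- t).
Proof.
rewrite /phase_mx tr_diag_mx map_diag_mx; congr diag_mx.
by apply/rowP => j; rewrite !mxE mulNr -conj_cis.
Qed.

Lemma phase_mx_unitary (R : realType) n (d : 'rV[R]_n) (t : R) :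
  phase_mx d t \is unitarymx.
Proof.
apply/unitarymxP; rewrite conj_phase_mx mulmx_diag.
apply/matrixP => i j; rewrite !mxE.
by rewrite -cisD mulNr subrr cis0.
Qed.

Lemma det_phase_mx (R : realType) n (d : 'rV[R]_n) (t : R) :
  \det (phase_mx d t) = cis (t * \sum_j d 0 j).
Proof.
rewrite det_diag mulr_sumr cis_sum; apply: eq_bigr => j _.
by rewrite mxE.
Qed.

(** In an eigenbasis each entry of the evolved state only rotates, at a frequency
    which is a difference of two eigenvalues; the products of matrices are gone and
    the evolution can be differentiated entry by entry. *)
Lemma phase_mx_conj_entry (R : realType) n (d : 'rV[R]_n) (S : 'M[R[i]]_n) (t : R) i j :
  (phase_mx d t *m S *m (phase_mx d t)^t*) i j = cis (t * (d 0 i - d 0 j)) * S i j.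
Proof.
rewrite conj_phase_mx mul_diag_mx mul_mx_diag !mxE mulrAC -cisD.
by rewrite mulrBr mulNr.
Qed.

(** The frequencies of [phase_mx_conj_entry] are exactly the factors produced by
    the commutator with a diagonal matrix; this is where the commutator in the
    von Neumann equation comes from. *)
Lemma commutator_diag (R : realType) n (d : 'rV[R]_n) (X : 'M[R[i]]_n) i j :
  commutator_mx (diag_mx (complexmx d)) X i j = (d 0 i - d 0 j)%:C%C * X i j.
Proof.
by rewrite /commutator_mx mul_diag_mx mul_mx_diag !mxE rmorphB /=; ring.
Qed.

Lemma cvg_quotient_phase_conj (R : realType) n (d : 'rV[R]_n) (X : 'M[R[i]]_n) (t : R) :
  let Z s := phase_mx d s *m X *m (phase_mx d s)^t* in forall i j,
  ((h%:C%C)^-1 *: (Z (t + h) - Z t)) i j @[h --> (0 : R)^'] -->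
    ('i *: commutator_mx (diag_mx (complexmx d)) (Z t)) i j.
Proof.
move=> Z i j.
have ZE s : Z s i j = cis (s * (d 0 i - d 0 j)) * X i j by exact: phase_mx_conj_entry.
clearbody Z.
have -> : ('i *: commutator_mx (diag_mx (complexmx d)) (Z t)) i j =
    'i * (d 0 i - d 0 j)%:C%C * cis (t * (d 0 i - d 0 j)) * X i j.
  by rewrite [LHS]mxE commutator_diag ZE !mulrA.
have E h : ((h%:C%C)^-1 *: (Z (t + h) - Z t)) i j =
    (h%:C%C)^-1 * (cis ((t + h) * (d 0 i - d 0 j)) - cis (t * (d 0 i - d 0 j))) * X i j.
  by rewrite [LHS]mxE [X in _ * X = _]mxE [X in _ * (_ + X) = _]mxE !ZE -mulrBl mulrA.
under eq_fun do rewrite E.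
apply: cvgM; [exact: cvg_quotient_cis | exact: cvg_cst].
Qed.

(** The equation is unchanged by a unitary change of basis, which reduces it to
    a diagonal generator. *)
Lemma derivative_hermitian_evolution (R : realType) n (P S0 : 'M[R[i]]_n) (d : 'rV[R]_n) (t : R) :
  P \is unitarymx ->
  let G := P^t* *m diag_mx (complexmx d) *m P in
  let U t := P^t* *m phase_mx d t *m P in
  let S t := U t *m S0 *m (U t)^t* in
  has_real_derivative S t ('i *: commutator_mx G (S t)).
Proof.
move=> Pu G U S.
pose Z s := phase_mx d s *m (P *m S0 *m P^t*) *m (phase_mx d s)^t*.
have SE s : S s = P^t* *m Z s *m P.
  by rewrite /S /U !trmx_mul !map_mxM /= trmxCK !mulmxA.
have -> : 'i *: commutator_mx G (S t) =
    P^t* *m ('i *: commutator_mx (diag_mx (complexmx d)) (Z t)) *m P.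
  rewrite -conjmx_trmxCZ SE; congr (_ *: _).
  by rewrite /commutator_mx /G !(unitary_conjmxM _ _ Pu) conjmx_trmxCB.
rewrite /has_real_derivative.
have -> : (fun h => (h%:C%C)^-1 *: (S (t + h) - S t)) =
   fun h => P^t* *m ((h%:C%C)^-1 *: (Z (t + h) - Z t)) *m P.
  by apply/funext => h; rewrite !SE conjmx_trmxCB conjmx_trmxCZ.
apply: cvg_mulmx_entrywise => i j.
exact: cvg_quotient_phase_conj.
Qed.

(** * Real unitary matrices *)

Lemma real_mx_complexmx (R : realType) m n (X : 'M[R[i]]_(m, n)) :
  map_mx Num.conj X = X -> X = complexmx (map_mx (@complex.Re R) X).
Proof.
move=> Xr; apply/matrixP => i j; rewrite !mxE RRe_real//.
by apply/CrealP; rewrite -[in RHS]Xr mxE.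
Qed.

Lemma real_unitary_orthogonal (R : realType) n (V : 'M[R]_n) :
  complexmx V \is unitarymx -> V^T *m V = 1%:M.
Proof.
move=> Vu; apply: (@map_mx_inj _ _ (real_complex R)).
rewrite map_mxM -map_trmx map_mx1.
have -> : (map_mx (real_complex R) V)^T = (complexmx V)^t*.
  by apply/matrixP => i j; rewrite !mxE conj_real_complex.
exact: trmxC_mul_unitary.
Qed.

(** * The Hermitian matrix of a reversible generator *)

(** By detailed balance, a state from which a positive rate leads to a state of
    mass zero has mass zero as well. Following paths, one massless state would make
    all states massless, and the total mass is one. *)
Lemma stationary_prob_gt0 (R : realType) M (Q : 'M[R]_M) (nu : 'cV[R]_M) :
  irreducible_generator Q -> stationary_prob Q nu -> reversible Q nu ->
  forall i, 0 < nu i 0.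
Proof.
move=> Qirr [nu_ge0 nu_sum _] Qrev i; rewrite lt_neqAle nu_ge0 andbT.
apply/eqP => nui0.
have nu0 j : nu j 0 = 0.
  have /connectP[p] := Qirr j i; elim: p j => [|k p IH] j /=; first by move=> _ <-.
  move=> /andP[/andP[_ Qjk] kp] ip.
  have /eqP := Qrev j k; rewrite (IH k kp ip) mul0r mulf_eq0 (gt_eqF Qjk) orbF.
  by move/eqP.
by move: nu_sum; rewrite big1// => /esym/eqP; rewrite oner_eq0.
Qed.

(** Detailed balance says that D^2 P is symmetric. Positivity of [nu] is needed
    for D to be invertible. *)
Lemma symmetrized_sym (R : realType) M (Q : 'M[R]_M) (nu : 'cV[R]_M) (Lambda : R) :
  (forall i, 0 < nu i 0) -> reversible Q nu ->
  (symmetrized Lambda Q nu)^T = symmetrized Lambda Q nu.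
Proof.
move=> nu_gt0 Qrev; pose D : 'M[R]_M := sqrt_diag nu.
have Du : D \in unitmx.
  rewrite unitmxE det_diag unitfE; apply/prodf_neq0 => i _.
  by rewrite mxE sqrtr_eq0 -ltNge.
have Dsym : D^T = D by exact: tr_diag_mx.
have DD : D *m D *m uniformized Lambda Q = (uniformized Lambda Q)^T *m (D *m D).
  rewrite mulmx_diag mul_diag_mx mul_mx_diag; apply/matrixP => i j.
  rewrite !mxE -!expr2 !sqr_sqrtr ?ltW// mulrDr mulrDl mulrCA Qrev.
  rewrite -mulrA (mulrC (Q j i)) eq_sym; congr (_ + _).
  by have [->|_] := eqVneq j i; rewrite ?mulr0 ?mul0r// mulrC.
rewrite /symmetrized -/D !trmx_mul trmx_inv Dsym.
(* Multiplying by D on both sides turns the goal into [DD]. *)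
apply: (can_inj (mulKmx Du)); apply: (can_inj (mulmxK Du)).
by rewrite mulKVmx// -!mulmxA mulVmx// mulmx1 -DD mulmxA.
Qed.

(** [sigma_y] is Hermitian, and so is a real symmetric [A]. *)
Lemma K_mx_hermitian (R : realType) M (A : 'M[R]_M) :
  A^T = A -> K_mx A \is hermsymmx.
Proof.
move=> Asym; apply/is_hermitianmxP; rewrite expr0 scale1r /K_mx trmx_tens map_mxT.
congr tensmx; apply/matrixP => i j; rewrite !mxE.
  case: i => -[|[|//]] hi; case: j => -[|[|//]] hj /=; rewrite ?rmorph0 ?rmorphN /= ?conjCi//.
  by rewrite opprK.
by rewrite [RHS]conj_real_complex -[in LHS]Asym mxE.
Qed.

(** The diagonal of [sigma_y] is zero. *)
Lemma K_mx_trace (R : realType) M (A : 'M[R]_M) : \tr (K_mx A) = 0.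
Proof.
rewrite /mxtrace big1// => i _; case: i / (mxtens_indexP i) => a k.
rewrite tensmxE !mxE; case: a => -[|[|//]] ha /=; exact: mul0r.
Qed.

(** The entries of [sigma_y] are purely imaginary, hence so are those of [K_mx A]
    for a real [A]. *)
Lemma iK_mx_real (R : realType) M (A : 'M[R]_M) (t : R) :
  map_mx Num.conj (('i * t%:C%C) *: K_mx A) = ('i * t%:C%C) *: K_mx A.
Proof.
have conjK : map_mx Num.conj (K_mx A) = - K_mx A.
  rewrite /K_mx map_mxT; apply/matrixP => i j.
  case: i / (mxtens_indexP i) => a k; case: j / (mxtens_indexP j) => b l.
  rewrite [in RHS]mxE !tensmxE -mulNr !mxE /= conj_real_complex; congr (_ * _).
  case: a => -[|[|//]] ha; case: b => -[|[|//]] hb /=;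
    by rewrite ?rmorph0 ?oppr0 ?rmorphN /= ?conjCi.
by rewrite map_mxZ conjK rmorphM /= conjCi conj_real_complex mulNr scaleNr scalerN opprK.
Qed.

(** * The orthogonal evolution *)

Theorem theorem6p1 (R : realType) (M : nat) (M_ge2 : (2 <= M)%N)
    (Q : 'M[R]_M) (Q_gen : is_generator Q) (Q_irr : irreducible_generator Q)
    (nu : 'cV[R]_M) (nu_stat : stationary_prob Q nu) (Q_rev : reversible Q nu)
    (Lambda : R) (Lambda_gt0 : 0 < Lambda)
    (Lambda_ge : forall i, - Q i i <= Lambda) :
  let A := symmetrized Lambda Q nu in
  let H := H_NUO A in
  let U := fun theta : R => W_mx A ('i * theta%:C%C) in
  [/\ forall theta,
        exists2 V : 'M[R]_(2 * M), special_orthogonal V & U theta = complexmx V,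
      forall theta, U theta \is unitarymx,
      [/\ H = - tensmx sigma_y (complexmx A), H \is hermsymmx &
        forall theta, U theta = mexp ((- 'i * theta%:C%C) *: H)] &
      forall sigma0 : 'M[R[i]]_(2 * M), density_mx sigma0 ->
        let sigma := fun theta => U theta *m sigma0 *m (U theta) ^t* in
        forall theta, density_mx (sigma theta) /\
          has_real_derivative sigma theta
            (- 'i *: commutator_mx H (sigma theta))].
Proof.
move=> A H U.
have Kh : K_mx A \is hermsymmx.
  apply/K_mx_hermitian/symmetrized_sym => //.
  exact: stationary_prob_gt0 Q_irr nu_stat Q_rev.
have [P Pu [d Kd]] := hermitian_spectral Kh.
have expK t := cvg_exp_hermitian (d := d) (t := t) Pu; rewrite -Kd in expK.
have UE t : U t = P^t* *m phase_mx d t *m P by apply: mexpE; exact: expK.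
have Uu t : U t \is unitarymx.
  by rewrite UE !mul_unitarymx ?trmxC_unitary ?phase_mx_unitary.
(* The sum of the eigenvalues is the trace of K, which vanishes. *)
have Udet t : \det (U t) = 1.
  rewrite UE unitary_conjmx_det// det_phase_mx (_ : \sum_j _ = 0) ?mulr0 ?cis0//.
  apply: complexI; rewrite rmorph_sum rmorph0 -[RHS](K_mx_trace A) Kd.
  rewrite unitary_conjmx_trace// mxtrace_diag.
  by apply: eq_bigr => j _; rewrite mxE.
split.
- move=> t; have Ureal : U t = complexmx (map_mx (@complex.Re R) (U t)).
    apply: real_mx_complexmx; rewrite UE.
    exact: conj_cvg_exp (expK t) (iK_mx_real A t).
  exists (map_mx (@complex.Re R) (U t)) => //; split.
    by have := Uu t; rewrite {1}Ureal; exact: real_unitary_orthogonal.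
  by apply: complexI; rewrite rmorph1 -det_map_mx -/(complexmx _) -Ureal.
- exact: Uu.
- split; [by []| |move=> t].
    apply/is_hermitianmxP; rewrite {1}/H /H_NUO (is_hermitianmxP _ _ _ Kh).
    by rewrite !expr0 !scale1r raddfN map_mxN.
  by rewrite /U /W_mx /H /H_NUO mulNr scaleNr scalerN opprK.
- move=> S0 S0d S t; split; first exact: (density_mx_unitary (Uu t) S0d).
  have -> : - 'i *: commutator_mx H (S t) = 'i *: commutator_mx (K_mx A) (S t).
    rewrite /commutator_mx /H /H_NUO mulNmx mulmxN opprK scaleNr -scalerN.
    by rewrite opprD opprK.
  rewrite /S (funext UE) Kd.
  exact: derivative_hermitian_evolution.
Qed.
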